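(* Let $s$ and $n$ be integers such that $0\le s<\left\lfloor \frac{n}{2}\right\rfloor$. Then $$\int_0^{1}\frac{t^{2s}}{\cos (2 n \sin^{-1}\sqrt{t})+\cosh (2 n \sinh^{-1}\sqrt{t})}\;\frac{dt}{\sqrt{1-t^2}}=\frac{\pi (-1)^s}{2^{2 s+1} n}\sum _{j=1}^{\lfloor n/2\rfloor} \frac{(-1)^{j-1} \tan \frac{\pi (2 j-1)}{2 n}}{\cosh \left(n \sinh ^{-1}\tan \frac{\pi (2 j-1)}{2 n}\right)}\left(\frac{\sin ^2\frac{\pi (2 j-1)}{2 n}}{\cos \frac{\pi (2 j-1)}{2 n}}\right)^{2 s}.$$
   Context: Here $\sin^{-1}$ and $\sinh^{-1}$ denote the (principal) inverse functions $\arcsin$ and $\operatorname{arcsinh}$, not reciprocals. *)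

(* Defs.v *)
From Stdlib Require Import Reals.
From Coquelicot Require Import Coquelicot.
Open Scope R_scope.

Definition integrand (s n : nat) (t : R) : R :=
  t ^ (2 * s)
  / (cos (2 * INR n * asin (sqrt t)) + cosh (2 * INR n * arcsinh (sqrt t)))
  * (1 / sqrt (1 - t ^ 2)).

Definition node (n j : nat) : R := PI * (2 * INR j - 1) / (2 * INR n).

Definition summand (s n j : nat) : R :=
  (-1) ^ (j - 1) * tan (node n j)
  / cosh (INR n * arcsinh (tan (node n j)))
  * (sin (node n j) ^ 2 / cos (node n j)) ^ (2 * s).

(* Main.v *)
(* Write [D t] for the trigonometric-hyperbolic denominator.  Since
   [cos (2 asin (sqrt t)) = 1 - 2 t] and [cosh (2 arcsinh (sqrt t)) = 1 + 2 t],
   [D t = T_n (1 - 2 t) + T_n (1 + 2 t)] with [T_n] the Chebyshev polynomial; this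
   is a polynomial of degree at most [n / 2] in [z = t ^ 2].  The identity
   [T_n p + T_n q = 2 T_n x T_n y], valid when [p + q = 2 x y] and
   [p q = x ^ 2 + y ^ 2 - 1], shows that at [z = - (1 / c - c) ^ 2 / 4], where
   [c = cos x], it equals [2 cos (n x) cosh (n arcsinh (tan x))].  So its zeros are
   the [n / 2] values of [z] for [x] a node, the chain rule in [x] gives its
   derivative there, and the partial fraction expansion of [t ^ (2 s) / D t]
   reduces the claim to the integral of [1 / ((t ^ 2 + a ^ 2) sqrt (1 - t ^ 2))]. *)
Require Import Defs.
From Stdlib Require Import Reals Lra Lia IndefiniteDescription.
From Coquelicot Require Import Coquelicot.
Open Scope R_scope.

(** * Polynomial functions *)

(* [f] is a polynomial function of degree [< d]. *)
Fixpoint poly_lt (d : nat) (f : R -> R) : Prop :=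
  match d with
  | O => forall x, f x = 0
  | S d' => exists c g, poly_lt d' g /\ forall x, f x = c + x * g x
  end.

Lemma poly_lt_ext d f g : (forall x, f x = g x) -> poly_lt d f -> poly_lt d g.
Proof.
  intros Hfg; destruct d as [|d]; simpl.
  - intros H x; rewrite <- Hfg; apply H.
  - intros [c [h [Hh H]]]; exists c, h; split; [exact Hh|].
    intros x; rewrite <- Hfg; apply H.
Qed.

Lemma poly_lt_succ d f : poly_lt d f -> poly_lt (S d) f.
Proof.
  revert f; induction d as [|d IH]; intros f.
  - intros H; exists 0, (fun _ => 0); split; [now intros|].
    intros x; rewrite (H x); ring.
  - intros [c [g [Hg H]]]; exists c, g; split; [apply IH, Hg|exact H].
Qed.

Lemma poly_lt_weaken d e f : (d <= e)%nat -> poly_lt d f -> poly_lt e f.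
Proof.
  intros Hde Hf; induction Hde as [|e _ IH]; [exact Hf|apply poly_lt_succ, IH].
Qed.

Lemma poly_lt_plus d f g :
  poly_lt d f -> poly_lt d g -> poly_lt d (fun x => f x + g x).
Proof.
  revert f g; induction d as [|d IH]; intros f g.
  - intros Hf Hg x; rewrite (Hf x), (Hg x); ring.
  - intros [c [f' [Hf' Hf]]] [e [g' [Hg' Hg]]].
    exists (c + e), (fun x => f' x + g' x); split; [apply IH; assumption|].
    intros x; rewrite Hf, Hg; ring.
Qed.

Lemma poly_lt_scal d k f : poly_lt d f -> poly_lt d (fun x => k * f x).
Proof.
  revert f; induction d as [|d IH]; intros f.
  - intros Hf x; rewrite (Hf x); ring.
  - intros [c [f' [Hf' Hf]]].
    exists (k * c), (fun x => k * f' x); split; [apply IH; assumption|].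
    intros x; rewrite Hf; ring.
Qed.

Lemma poly_lt_const c : poly_lt 1 (fun _ => c).
Proof. exists c, (fun _ => 0); split; [now intros|intros; ring]. Qed.

Lemma poly_lt_mulX d f : poly_lt d f -> poly_lt (S d) (fun x => x * f x).
Proof. intros Hf; exists 0, f; split; [exact Hf|intros; ring]. Qed.

Lemma poly_lt_pow k : poly_lt (S k) (fun x => x ^ k).
Proof.
  induction k as [|k IH]; [exact (poly_lt_const 1)|exact (poly_lt_mulX _ _ IH)].
Qed.

Lemma poly_lt_sum d (f : nat -> R -> R) k :
  (forall j, (j <= k)%nat -> poly_lt d (f j)) ->
  poly_lt d (fun x => sum_n (fun j => f j x) k).
Proof.
  induction k as [|k IH]; intros Hf.
  - apply poly_lt_ext with (f 0%nat); [intros x; now rewrite sum_O|].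
    now apply Hf.
  - apply poly_lt_ext with (fun x => sum_n (fun j => f j x) k + f (S k) x).
    { intros x; now rewrite sum_Sn. }
    apply poly_lt_plus; [apply IH; intros; apply Hf; lia|apply Hf; lia].
Qed.

Lemma poly_lt_ex_derive d f x : poly_lt d f -> ex_derive f x.
Proof.
  revert f; induction d as [|d IH]; intros f.
  - intros Hf; apply ex_derive_ext with (fun _ => 0); [intros; now rewrite Hf|].
    apply ex_derive_const.
  - intros [c [g [Hg Hf]]].
    apply ex_derive_ext with (fun x => c + x * g x); [intros; now rewrite Hf|].
    auto_derive; now apply IH.
Qed.

(** Synthetic division: if [f x = c + x * f' x] and [f' x = f' r + (x - r) * g x], then
    [f x - f r = (x - r) * (f' r + x * g x)]. *)
Lemma poly_lt_factor d f r :
  poly_lt (S d) f -> exists g, poly_lt d g /\ forall x, f x = f r + (x - r) * g x.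
Proof.
  revert f; induction d as [|d IH]; intros f [c [f' [Hf' Hf]]].
  - exists (fun _ => 0); split; [now intros|].
    intros x; rewrite !Hf, !(Hf' _); ring.
  - destruct (IH _ Hf') as [g [Hg Hfg]].
    exists (fun x => f' r + x * g x); split; [now exists (f' r), g|].
    intros x; rewrite !Hf, (Hfg x); ring.
Qed.

(** Split off the factor of the last zero; since the zeros are distinct, the quotient vanishes at
    the others, and it has smaller degree. *)
Lemma poly_lt_zeros d f (z : nat -> R) :
  poly_lt d f ->
  (forall i j, (i < d)%nat -> (j < d)%nat -> z i = z j -> i = j) ->
  (forall i, (i < d)%nat -> f (z i) = 0) -> forall x, f x = 0.
Proof.
  revert f; induction d as [|d IH]; intros f Hf Hz H0; [exact Hf|].
  destruct (poly_lt_factor _ _ (z d) Hf) as [g [Hg Hfg]].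
  assert (Hg0 : forall x, g x = 0).
  { apply IH; [exact Hg|intros i j Hi Hj; apply Hz; lia|].
    intros i Hi.
    assert (Hzi : z i <> z d) by (intros E; apply Hz in E; lia).
    assert (E := Hfg (z i)); rewrite (H0 i), (H0 d) in E by lia.
    apply (Rmult_eq_reg_l (z i - z d)); [lra|now apply Rminus_eq_contra]. }
  intros x; rewrite Hfg, Hg0, (H0 d) by lia; ring.
Qed.

Lemma sum_n_single (u : nat -> R) m i :
  (i <= m)%nat -> (forall j, (j <= m)%nat -> j <> i -> u j = 0) ->
  sum_n u m = u i.
Proof.
  induction m as [|m IH]; intros Hi Hu.
  - rewrite sum_O; f_equal; lia.
  - rewrite sum_Sn; change (sum_n u m + u (S m) = u i).
    destruct (Nat.eq_dec i (S m)) as [->|Hne].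
    + rewrite (sum_n_ext_loc _ (fun _ => 0)) by (intros; apply Hu; lia).
      rewrite sum_n_const; ring.
    + rewrite IH, (Hu (S m)) by (intros; try apply Hu; lia); ring.
Qed.

(* Lagrange interpolation of [x ^ s] at the zeros of [E], using that
   [E x / (x - z j)] is the polynomial [g j], whose value at [z j] is [E'(z j)]. *)
Lemma partial_fractions m E (z : nat -> R) :
  poly_lt (S (S m)) E ->
  (forall i j, (i <= m)%nat -> (j <= m)%nat -> z i = z j -> i = j) ->
  (forall i, (i <= m)%nat -> E (z i) = 0) ->
  exists g : nat -> R -> R,
    (forall j, (j <= m)%nat ->
       ex_derive (g j) (z j) /\ forall x, E x = (x - z j) * g j x) /\
    ((forall j, (j <= m)%nat -> g j (z j) <> 0) ->
     forall s x, (s <= m)%nat ->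
       x ^ s = sum_n (fun j => z j ^ s / g j (z j) * g j x) m).
Proof.
  intros HE Hz H0.
  assert (Hg : forall j, exists g, (j <= m)%nat ->
      poly_lt (S m) g /\ forall x, E x = (x - z j) * g x).
  { intros j; destruct (poly_lt_factor _ _ (z j) HE) as [g [Hg HEg]].
    exists g; intros Hj; split; [exact Hg|].
    intros x; rewrite HEg, (H0 j Hj); ring. }
  apply functional_choice in Hg; destruct Hg as [g Hg].
  exists g; split.
  { intros j Hj; destruct (Hg j Hj) as [Hp HEg]; split; [|exact HEg].
    exact (poly_lt_ex_derive _ _ _ Hp). }
  (* The nonvanishing of [g j (z j)] is a premise because it is established only once [g] is in
     hand, by differentiating [E] at its zeros. The two sides then differ by a polynomial of degree
     at most [m] that vanishes at [m + 1] distinct points. *)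
  intros Hnz s x Hs.
  enough (HL : forall x,
    sum_n (fun j => z j ^ s / g j (z j) * g j x) m + (-1) * x ^ s = 0).
  { specialize (HL x); lra. }
  apply poly_lt_zeros with (S m) z.
  - apply poly_lt_plus.
    + apply (poly_lt_sum _ (fun j x => z j ^ s / g j (z j) * g j x)).
      intros j Hj; apply poly_lt_scal, Hg, Hj.
    + apply poly_lt_scal, poly_lt_weaken with (S s); [lia|apply poly_lt_pow].
  - intros i j Hi Hj; apply Hz; lia.
  - intros i Hi; assert (Hi' : (i <= m)%nat) by lia.
    rewrite (sum_n_single _ m i Hi').
    + field; apply Hnz, Hi'.
    + intros j Hj Hji.
      (* For [j <> i], the zero [z i] of [E] must be a zero of the cofactor [g j]. *)
      assert (Hzij : z i <> z j) by (intros e; apply Hz in e; lia).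
      destruct (Hg j Hj) as [_ HEg].
      replace (g j (z i)) with 0; [ring|].
      apply (Rmult_eq_reg_l (z i - z j)); [|now apply Rminus_eq_contra].
      rewrite <- HEg, H0 by lia; ring.
Qed.

(** * The denominator as a polynomial *)

(* In terms of [z = t ^ 2], this is [T_n (1 - 2 t) + T_n (1 + 2 t)] with [T_n]
   the Chebyshev polynomial: the characteristic polynomial of the recurrence is
   [(X^2 - 2 (1 - 2 t) X + 1) (X^2 - 2 (1 + 2 t) X + 1)]. *)
Fixpoint cheb_sum (n : nat) (z : R) : R :=
  match n with
  | O => 2
  | S n1 =>
    match n1 with
    | O => 2
    | S n2 =>
      match n2 with
      | O => 2 + 16 * z
      | S n3 =>
        match n3 with
        | O => 2 + 96 * z
        | S n4 => 4 * cheb_sum n1 z - (6 - 16 * z) * cheb_sum n2 z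
                  + 4 * cheb_sum n3 z - cheb_sum n4 z
        end
      end
    end
  end.

Lemma cheb_sum_rec n z : cheb_sum (S (S (S (S n)))) z =
  4 * cheb_sum (S (S (S n))) z - (6 - 16 * z) * cheb_sum (S (S n)) z
  + 4 * cheb_sum (S n) z - cheb_sum n z.
Proof. reflexivity. Qed.

Lemma nat_ind4 (P : nat -> Prop) :
  P 0%nat -> P 1%nat -> P 2%nat -> P 3%nat ->
  (forall n, P n -> P (S n) -> P (S (S n)) -> P (S (S (S n))) ->
     P (S (S (S (S n))))) ->
  forall n, P n.
Proof.
  intros H0 H1 H2 H3 HS n.
  enough (P n /\ P (S n) /\ P (S (S n)) /\ P (S (S (S n)))) by tauto.
  induction n as [|n IH]; [tauto|].
  destruct IH as (? & ? & ? & ?); auto.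
Qed.

(** Both closed forms of the denominator, as a sum and as a product, are identified with [cheb_sum]
    through this, so they agree with each other. *)
Lemma cheb_sum_unique (u : nat -> R) z :
  u 0%nat = 2 -> u 1%nat = 2 -> u 2%nat = 2 + 16 * z -> u 3%nat = 2 + 96 * z ->
  (forall n, u (S (S (S (S n)))) =
     4 * u (S (S (S n))) - (6 - 16 * z) * u (S (S n)) + 4 * u (S n) - u n) ->
  forall n, cheb_sum n z = u n.
Proof.
  intros H0 H1 H2 H3 HS n; induction n using nat_ind4; try (symmetry; assumption).
  rewrite cheb_sum_rec, HS; congruence.
Qed.

Lemma cheb_sum_poly_lt n : poly_lt (S (Nat.div n 2)) (cheb_sum n).
Proof.
  induction n as [| | | |n IH0 IH1 IH2 IH3] using nat_ind4.
  1, 2: exact (poly_lt_const 2).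
  1: exists 2, (fun _ => 16); split; [exact (poly_lt_const 16)|simpl; intros; ring].
  1: exists 2, (fun _ => 96); split; [exact (poly_lt_const 96)|simpl; intros; ring].
  assert (D : forall k, Nat.div (S (S k)) 2 = S (Nat.div k 2)).
  { intros k; replace (S (S k)) with (k + 1 * 2)%nat by lia.
    rewrite Nat.div_add; lia. }
  apply poly_lt_ext with (fun z => 4 * cheb_sum (S (S (S n))) z
    + (((-6) * cheb_sum (S (S n)) z + 16 * (z * cheb_sum (S (S n)) z))
      + (4 * cheb_sum (S n) z + (-1) * cheb_sum n z))).
  { intros z; rewrite cheb_sum_rec; ring. }
  assert (L := Nat.Div0.div_le_mono n (S n) 2 ltac:(lia)).
  rewrite !D in *.
  assert (L' : (Nat.div (S n) 2 <= S (Nat.div n 2))%nat).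
  { rewrite <- D; apply Nat.Div0.div_le_mono; lia. }
  repeat apply poly_lt_plus; try apply poly_lt_scal.
  - apply poly_lt_weaken with (2 := IH3); lia.
  - apply poly_lt_weaken with (2 := IH2); lia.
  (* The only term with a factor [z]: it sits two indices down, where the degree bound is one
     lower. *)
  - exact (poly_lt_mulX _ _ IH2).
  - apply poly_lt_weaken with (2 := IH1); lia.
  - apply poly_lt_weaken with (2 := IH0); lia.
Qed.

Lemma cos_SS n a :
  cos (INR (S (S n)) * a) = 2 * cos a * cos (INR (S n) * a) - cos (INR n * a).
Proof.
  rewrite !S_INR.
  replace ((INR n + 1 + 1) * a) with ((INR n + 1) * a + a) by ring.
  replace (INR n * a) with ((INR n + 1) * a - a) by ring.
  rewrite cos_plus, cos_minus; ring.
Qed.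

Lemma cosh_SS n a :
  cosh (INR (S (S n)) * a) =
  2 * cosh a * cosh (INR (S n) * a) - cosh (INR n * a).
Proof.
  rewrite !S_INR; unfold cosh.
  replace ((INR n + 1 + 1) * a) with (INR n * a + (a + a)) by ring.
  replace ((INR n + 1) * a) with (INR n * a + a) by ring.
  rewrite !Ropp_plus_distr, !exp_plus, !(exp_Ropp a).
  assert (H := exp_pos a).
  field; lra.
Qed.

Lemma cheb_sum_cos_cosh t a b n : cos a = 1 - 2 * t -> cosh b = 1 + 2 * t ->
  cheb_sum n (t ^ 2) = cos (INR n * a) + cosh (INR n * b).
Proof.
  intros Ha Hb.
  assert (C0 : cos (INR 0 * a) = 1) by (rewrite Rmult_0_l; apply cos_0).
  assert (H0 : cosh (INR 0 * b) = 1) by (rewrite Rmult_0_l; apply cosh_0).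
  assert (C1 : cos (INR 1 * a) = 1 - 2 * t) by (rewrite Rmult_1_l; apply Ha).
  assert (H1 : cosh (INR 1 * b) = 1 + 2 * t) by (rewrite Rmult_1_l; apply Hb).
  apply (cheb_sum_unique (fun n => cos (INR n * a) + cosh (INR n * b)));
    intros; rewrite ?cos_SS, ?cosh_SS, ?C0, ?C1, ?H0, ?H1, ?Ha, ?Hb; ring.
Qed.

(** The product of solutions of [X^2 - 2 p X + 1] and [X^2 - 2 q X + 1] obeys the recurrence of [X^4
    - 4 p q X^3 + (4 p^2 + 4 q^2 - 2) X^2 - 4 p q X + 1]. For [q = / p] this is the recurrence of
    [cheb_sum] at the given point. *)
Lemma cheb_sum_prod p a b n : p <> 0 -> cos a = p -> cosh b = / p ->
  cheb_sum n (- (/ p - p) ^ 2 / 4) = 2 * cos (INR n * a) * cosh (INR n * b).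
Proof.
  intros Hp Ha Hb.
  assert (C0 : cos (INR 0 * a) = 1) by (rewrite Rmult_0_l; apply cos_0).
  assert (H0 : cosh (INR 0 * b) = 1) by (rewrite Rmult_0_l; apply cosh_0).
  assert (C1 : cos (INR 1 * a) = p) by (rewrite Rmult_1_l; apply Ha).
  assert (H1 : cosh (INR 1 * b) = / p) by (rewrite Rmult_1_l; apply Hb).
  apply (cheb_sum_unique (fun n => 2 * cos (INR n * a) * cosh (INR n * b)));
    intros; rewrite ?cos_SS, ?cosh_SS, ?C0, ?C1, ?H0, ?H1, ?Ha, ?Hb; field; exact Hp.
Qed.

(** * Improper integrals *)

Lemma is_RInt_gen_sum_n (Fa Fb : (R -> Prop) -> Prop) {FFa : Filter Fa}
    {FFb : Filter Fb} (f : nat -> R -> R) (l : nat -> R) m :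
  (forall j, (j <= m)%nat -> is_RInt_gen (f j) Fa Fb (l j)) ->
  is_RInt_gen (fun x => sum_n (fun j => f j x) m) Fa Fb (sum_n l m).
Proof.
  induction m as [|m IH]; intros H.
  - rewrite sum_O; apply is_RInt_gen_ext with (f 0%nat); [|now apply H].
    apply filter_forall; intros; now rewrite sum_O.
  - rewrite sum_Sn.
    apply is_RInt_gen_ext with
      (fun x => plus (sum_n (fun j => f j x) m) (f (S m) x)).
    { apply filter_forall; intros; now rewrite sum_Sn. }
    apply (is_RInt_gen_plus (fun x => sum_n (fun j => f j x) m) (f (S m))).
    + apply IH; intros j Hj; apply H; lia.
    + apply H; lia.
Qed.

Lemma eventually_lt_left_1 (P : R -> Prop) :
  (forall x, 0 < x < 1 -> P x) -> at_left 1 P.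
Proof.
  intros H; exists (mkposreal 1 Rlt_0_1); intros x Hx Hx1; apply H.
  apply Rabs_lt_between' in Hx; simpl in Hx; lra.
Qed.

Lemma filter_prod_0_left_1 (P : R -> Prop) :
  (forall x, 0 <= x < 1 -> P x) ->
  filter_prod (at_point 0) (at_left 1) (fun ab : R * R =>
    forall x, Rmin (fst ab) (snd ab) <= x <= Rmax (fst ab) (snd ab) -> P x).
Proof.
  intros HP; apply Filter_prod with (fun a => a = 0) (fun b => 0 < b < 1).
  - reflexivity.
  - now apply eventually_lt_left_1.
  - intros a b -> Hb x; simpl.
    rewrite Rmin_left, Rmax_right by lra; intros Hx; apply HP; lra.
Qed.

(** The open interval is what [is_RInt_gen_ext] asks for; the closed one above serves
    [is_RInt_gen_Derive]. *)
Lemma filter_prod_0_left_1_strict (P : R -> Prop) :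
  (forall x, 0 < x < 1 -> P x) ->
  filter_prod (at_point 0) (at_left 1) (fun ab : R * R =>
    forall x, Rmin (fst ab) (snd ab) < x < Rmax (fst ab) (snd ab) -> P x).
Proof.
  intros HP; apply Filter_prod with (fun a => a = 0) (fun b => 0 < b < 1).
  - reflexivity.
  - now apply eventually_lt_left_1.
  - intros a b -> Hb x; simpl.
    rewrite Rmin_left, Rmax_right by lra; intros Hx; apply HP; lra.
Qed.

(** With [t = sin u] the kernel becomes [du / (sin u ^ 2 + a ^ 2)], which integrates to
    [atan (b * tan u / a) / (a * b)] when [b ^ 2 = 1 + a ^ 2]. *)
Definition primitive (a b t : R) : R :=
  / (a * b) * atan (b * t / (a * sqrt (1 - t ^ 2))).

Lemma primitive_derive a b t : 0 < a -> 0 < b -> b ^ 2 = 1 + a ^ 2 -> -1 < t < 1 ->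
  is_derive (primitive a b) t (/ (t ^ 2 + a ^ 2) * (1 / sqrt (1 - t ^ 2))).
Proof.
  intros Ha Hb Hab Ht; unfold primitive.
  assert (Hr : 0 < 1 - t ^ 2) by nra.
  assert (Hs := sqrt_lt_R0 _ Hr).
  assert (Hss := sqrt_sqrt (1 - t ^ 2) ltac:(lra)).
  auto_derive.
  - replace (1 + - (t * (t * 1))) with (1 - t ^ 2) by ring.
    split; [exact Hr|split; [nra|exact I]].
  - replace (1 + - (t * (t * 1))) with (1 - t ^ 2) by ring.
    set (r := sqrt (1 - t ^ 2)) in *.
    (* The left side is the denominator that the derivative of [atan] produces. *)
    assert (Hb2 : b ^ 2 * t ^ 2 + a ^ 2 * r ^ 2 = t ^ 2 + a ^ 2).
    { replace (r ^ 2) with (1 - t ^ 2) by nra; rewrite Hab; ring. }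
    assert (0 < t ^ 2 + a ^ 2) by nra.
    assert (Ht2 : t ^ 2 = 1 - r * r) by lra.
    field_simplify_eq; [|repeat split; nra].
    transitivity (2 * a * b * ((t ^ 2 + a ^ 2) * (r * r + t ^ 2))); [ring|].
    transitivity (2 * a * b * (b ^ 2 * t ^ 2 + a ^ 2 * r ^ 2)); [|ring].
    rewrite Hss, Hb2; ring.
Qed.

Lemma primitive_lim a b : 0 < a -> 0 < b ->
  filterlim (primitive a b) (at_left 1) (locally (PI / (2 * a * b))).
Proof.
  intros Ha Hb.
  (* The argument of [atan] blows up at 1. Passing to its reciprocal by
     [atan y = PI / 2 - atan (/ y)] gives a function continuous at 1. *)
  set (H := fun t => / (a * b) * (PI / 2 - atan (a * sqrt (1 - t ^ 2) / (b * t)))).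
  assert (HH : H 1 = PI / (2 * a * b)).
  { unfold H; replace (1 - 1 ^ 2) with 0 by ring.
    rewrite sqrt_0, Rmult_0_r; unfold Rdiv at 2; rewrite Rmult_0_l, atan_0.
    field; lra. }
  apply filterlim_ext_loc with H.
  - apply eventually_lt_left_1; intros t Ht; unfold H, primitive.
    assert (Hs : 0 < sqrt (1 - t ^ 2)) by (apply sqrt_lt_R0; nra).
    rewrite <- atan_inv.
    + do 2 f_equal; field; lra.
    + apply Rdiv_lt_0_compat; nra.
  - rewrite <- HH; apply (filterlim_filter_le_1 (G := at_left 1) (F := locally 1)).
    + apply filter_le_within.
    + apply (continuous_scal_r (/ (a * b))
        (fun t => PI / 2 - atan (a * sqrt (1 - t ^ 2) / (b * t)))).
      apply @continuous_minus; [apply continuous_const|].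
      apply continuous_comp; [|apply continuous_atan].
      apply @continuous_mult.
      * apply @continuous_mult; [apply continuous_const|].
        apply (continuous_comp (fun t => 1 - t ^ 2) sqrt); [|apply continuous_sqrt].
        apply (ex_derive_continuous (V := R_NormedModule)); auto_derive; exact I.
      * apply (ex_derive_continuous (V := R_NormedModule)); auto_derive; lra.
Qed.

Lemma is_RInt_gen_kernel a b : 0 < a -> 0 < b -> b ^ 2 = 1 + a ^ 2 ->
  is_RInt_gen (fun t => / (t ^ 2 + a ^ 2) * (1 / sqrt (1 - t ^ 2)))
    (at_point 0) (at_left 1) (PI / (2 * a * b)).
Proof.
  intros Ha Hb Hab.
  apply is_RInt_gen_ext with (Derive (primitive a b)).
  { apply filter_prod_0_left_1_strict; intros t Ht.
    apply is_derive_unique, primitive_derive; lra. }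
  replace (PI / (2 * a * b)) with (PI / (2 * a * b) - 0) by ring.
  apply is_RInt_gen_Derive.
  - apply filter_prod_0_left_1; intros t Ht.
    eexists; apply primitive_derive; lra.
  - apply filter_prod_0_left_1; intros t Ht.
    apply continuous_ext_loc with
      (fun t => / (t ^ 2 + a ^ 2) * (1 / sqrt (1 - t ^ 2))).
    (* As [0 <= t], the radius [1 - t] keeps [u] inside [(-1, 1)], where the derivative is known. *)
    + assert (Hp : 0 < 1 - t) by lra.
      exists (mkposreal _ Hp); intros u Hu.
      apply Rabs_lt_between' in Hu; simpl in Hu.
      symmetry; apply is_derive_unique, primitive_derive; lra.
    + apply (ex_derive_continuous (V := R_NormedModule)); auto_derive.
      replace (1 + - (t * (t * 1))) with (1 - t ^ 2) by ring.
      assert (0 < 1 - t ^ 2) by nra.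
      assert (Hs := sqrt_lt_R0 _ H).
      repeat split; nra.
  - intros P HP; apply locally_singleton in HP.
    unfold filtermap, at_point, primitive.
    replace (/ (a * b) * _) with 0; [exact HP|].
    unfold Rdiv; rewrite Rmult_0_r, Rmult_0_l, atan_0; ring.
  - now apply primitive_lim.
Qed.

(** * Poles and residues *)

Lemma cosh_sq x : cosh x ^ 2 = 1 + sinh x ^ 2.
Proof.
  unfold cosh, sinh; rewrite exp_Ropp; assert (H := exp_pos x); field; lra.
Qed.

Lemma cosh_pos x : 0 < cosh x.
Proof.
  unfold cosh; assert (H := exp_pos x); assert (H' := exp_pos (- x)); lra.
Qed.

Lemma cosh_gt_1 x : 0 < x -> 1 < cosh x.
Proof.
  intros Hx; apply sinh_lt in Hx; rewrite sinh_0 in Hx.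
  assert (H := cosh_sq x); assert (H' := cosh_pos x); nra.
Qed.

Lemma cosh_2a_sinh x : cosh (2 * x) = 1 + 2 * sinh x ^ 2.
Proof.
  replace (2 * x) with (x + x) by ring; unfold cosh, sinh.
  rewrite !exp_Ropp, exp_plus; assert (H := exp_pos x); field; lra.
Qed.

Lemma cosh_arcsinh_tan x : 0 < cos x -> cosh (arcsinh (tan x)) = / cos x.
Proof.
  intros Hx.
  assert (H := cosh_sq (arcsinh (tan x))); rewrite sinh_arcsinh in H.
  assert (H' := cosh_pos (arcsinh (tan x))).
  apply Rinv_0_lt_compat in Hx as Hi.
  assert (Hs : 1 + tan x ^ 2 = (/ cos x) ^ 2).
  { unfold tan; assert (Hsc := sin2_cos2 x); unfold Rsqr in Hsc.
    transitivity ((sin x * sin x + cos x * cos x) / cos x ^ 2); [field; lra|].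
    rewrite Hsc; field; lra. }
  apply Rsqr_inj; unfold Rsqr; lra.
Qed.

Lemma sin_cos_INR_PI i : sin (INR i * PI) = 0 /\ cos (INR i * PI) = (-1) ^ i.
Proof.
  induction i as [|i [IHs IHc]].
  - simpl INR; rewrite Rmult_0_l, sin_0, cos_0; split; reflexivity.
  - rewrite S_INR, Rmult_plus_distr_r, Rmult_1_l, neg_sin, neg_cos, IHs, IHc.
    simpl; split; ring.
Qed.

Lemma node_bounds n i : (i < Nat.div n 2)%nat -> 0 < node n (S i) < PI / 2.
Proof.
  intros Hi; assert (Hn := Nat.Div0.mul_div_le n 2).
  assert (H : 2 * (INR i + 1) <= INR n).
  { rewrite <- S_INR; change 2 with (INR 2); rewrite <- mult_INR; apply le_INR; lia. }
  assert (H0 := pos_INR i); assert (Hp := PI_RGT_0).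
  unfold node; rewrite S_INR; split.
  - apply Rdiv_lt_0_compat; nra.
  - apply Rlt_div_l; [lra|].
    replace (PI / 2 * (2 * INR n)) with (PI * INR n) by field; nra.
Qed.

Lemma node_inj n i j :
  (0 < n)%nat -> node n (S i) = node n (S j) -> i = j.
Proof.
  intros Hn H; apply lt_0_INR in Hn; assert (Hp := PI_RGT_0).
  apply INR_eq.
  replace (INR i) with ((node n (S i) * (2 * INR n) / PI - 1) / 2)
    by (unfold node; rewrite S_INR; field; lra).
  rewrite H; unfold node; rewrite S_INR; field; lra.
Qed.

Lemma sin_cos_node n i : (0 < n)%nat ->
  sin (INR n * node n (S i)) = (-1) ^ i /\ cos (INR n * node n (S i)) = 0.
Proof.
  intros Hn; apply lt_0_INR in Hn.
  replace (INR n * node n (S i)) with (PI / 2 + INR i * PI)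
    by (unfold node; rewrite S_INR; field; lra).
  rewrite <- cos_sin; destruct (sin_cos_INR_PI i) as [Hs Hc].
  split; [exact Hc|].
  rewrite cos_plus, cos_PI2, Hs; ring.
Qed.

(** This is [- (sin x ^ 2 / cos x) ^ 2 / 4]; its [s]-th power yields the sign, the power of 2 and
    the last factor of the summand. *)
Definition pole (x : R) : R := - (/ cos x - cos x) ^ 2 / 4.

Lemma pole_inj x y :
  0 < x < PI / 2 -> 0 < y < PI / 2 -> pole x = pole y -> x = y.
Proof.
  intros Hx Hy H; unfold pole in H.
  apply cos_inj; try lra.
  assert (B : forall u, 0 < u < PI / 2 -> 0 < cos u /\ 0 < / cos u - cos u).
  { intros u Hu; assert (Hc : 0 < cos u) by (apply cos_gt_0; lra).
    assert (Hs : 0 < sin u) by (apply sin_gt_0; lra).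
    split; [exact Hc|].
    replace (/ cos u - cos u) with (sin u ^ 2 / cos u).
    - apply Rdiv_lt_0_compat; nra.
    - assert (Hsc := sin2_cos2 u); unfold Rsqr in Hsc.
      field_simplify_eq; nra. }
  destruct (B x Hx) as [Hcx Hdx], (B y Hy) as [Hcy Hdy].
  (* Both differences are positive, so equal squares make them equal; [/ c - c] is injective in
     [c > 0] by the factorization that follows. *)
  assert (Hd : / cos x - cos x = / cos y - cos y) by nra.
  assert (Hf : (cos x - cos y) * (1 + cos x * cos y) = 0).
  { replace ((cos x - cos y) * (1 + cos x * cos y)) with
      (cos x * cos y * ((/ cos y - cos y) - (/ cos x - cos x)))
      by (field; lra).
    rewrite Hd; ring. }
  apply Rmult_integral in Hf; destruct Hf as [Hf|Hf]; nra.
Qed.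

Lemma cheb_sum_pole n x : 0 < cos x ->
  cheb_sum n (pole x) = 2 * cos (INR n * x) * cosh (INR n * arcsinh (tan x)).
Proof.
  intros Hx; apply cheb_sum_prod; [lra|reflexivity|now apply cosh_arcsinh_tan].
Qed.

Lemma derive_pole x : 0 < cos x ->
  is_derive pole x (- sin x * (1 - cos x ^ 4) / (2 * cos x ^ 3)).
Proof.
  intros Hx; unfold pole; auto_derive; [lra|field; lra].
Qed.

(* The chain rule along [x |-> pole x] expresses [g (pole x)], the derivative of
   [cheb_sum n] at [pole x]. *)
Lemma quotient_at_pole n g x :
  0 < cos x -> cos (INR n * x) = 0 -> ex_derive g (pole x) ->
  (forall y, cheb_sum n y = (y - pole x) * g y) ->
  g (pole x) * (sin x * (1 - cos x ^ 4)) =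
  4 * INR n * sin (INR n * x) * cosh (INR n * arcsinh (tan x)) * cos x ^ 3.
Proof.
  intros Hx Hn [dg Hg] HE.
  set (h := fun u => cosh (INR n * arcsinh (tan u))).
  assert (Hh : ex_derive h x).
  { unfold h; apply ex_derive_comp with (f := cosh).
    - exists (sinh (INR n * arcsinh (tan x))); apply is_derive_Reals, derivable_pt_lim_cosh.
    - apply ex_derive_scal, ex_derive_comp with (f := arcsinh).
      + eexists; apply is_derive_Reals, derivable_pt_lim_arcsinh.
      + eexists; apply is_derive_tan; lra. }
  destruct Hh as [dh Hh].
  (* The factor [pole u - pole x] vanishes at [u = x], so the derivative of [g] drops out. *)
  assert (D1 : is_derive (fun u => cheb_sum n (pole u)) x
    (- sin x * (1 - cos x ^ 4) / (2 * cos x ^ 3) * g (pole x))).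
  { apply is_derive_ext with (fun u => (pole u - pole x) * g (pole u)).
    { intros; now rewrite HE. }
    assert (Hp := derive_pole x Hx).
    evar_last.
    - apply @is_derive_mult; [|apply is_derive_comp with (f := g); [exact Hg|exact Hp]|exact Rmult_comm].
      apply @is_derive_minus; [exact Hp|apply is_derive_const].
    - unfold minus, plus, opp, zero, mult, scal; simpl; unfold mult; simpl; ring. }
  (* The product form holds only where [cos u > 0], hence near [x]; [cos (n x) = 0] removes the term
     with the derivative of [h]. *)
  assert (D2 : is_derive (fun u => cheb_sum n (pole u)) x
    (- 2 * INR n * sin (INR n * x) * h x)).
  { apply is_derive_ext_loc with (fun u => 2 * cos (INR n * u) * h u).
    { assert (Hc : continuous cos x) by apply continuous_cos.
      apply (filter_imp (fun u => 0 < cos u)).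
      - intros u Hu; unfold h; now rewrite cheb_sum_pole.
      - apply Hc, open_gt, Hx. }
    evar_last.
    - apply @is_derive_mult; [|exact Hh|exact Rmult_comm].
      auto_derive; [exact I|reflexivity].
    - unfold plus, mult; simpl; rewrite Hn; ring. }
  assert (H := eq_trans (eq_sym (is_derive_unique _ _ _ D1)) (is_derive_unique _ _ _ D2)).
  fold (h x).
  apply (Rmult_eq_reg_r (- / (2 * cos x ^ 3))).
  - transitivity (- sin x * (1 - cos x ^ 4) / (2 * cos x ^ 3) * g (pole x)); [field; lra|].
    rewrite H; field; lra.
  - apply Ropp_neq_0_compat, Rinv_neq_0_compat, Rmult_integral_contrapositive_currified; [lra|].
    apply pow_nonzero; lra.
Qed.

Lemma denominator_cheb_sum n t : 0 < t < 1 ->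
  cos (2 * INR n * asin (sqrt t)) + cosh (2 * INR n * arcsinh (sqrt t)) =
  cheb_sum n (t ^ 2).
Proof.
  intros Ht.
  assert (Hs := sqrt_sqrt t ltac:(lra)).
  assert (H1 : 0 < sqrt t) by (apply sqrt_lt_R0; lra).
  rewrite (cheb_sum_cos_cosh t (2 * asin (sqrt t)) (2 * arcsinh (sqrt t))).
  - f_equal; f_equal; ring.
  - rewrite cos_2a_sin, sin_asin by nra; nra.
  - rewrite cosh_2a_sinh, sinh_arcsinh; nra.
Qed.

(** The cosine is at least -1, and the hyperbolic cosine of a positive argument exceeds 1. *)
Lemma denominator_pos n t : (0 < n)%nat -> 0 < t < 1 -> 0 < cheb_sum n (t ^ 2).
Proof.
  intros Hn Ht; apply lt_0_INR in Hn.
  rewrite <- denominator_cheb_sum by exact Ht.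
  assert (H1 : 0 < sqrt t) by (apply sqrt_lt_R0; lra).
  apply arcsinh_lt in H1; rewrite arcsinh_0 in H1.
  assert (H2 := COS_bound (2 * INR n * asin (sqrt t))).
  assert (H3 : 1 < cosh (2 * INR n * arcsinh (sqrt t))) by (apply cosh_gt_1; nra).
  lra.
Qed.

(* With [c = cos x], [- pole x = a ^ 2] for [a = (/ c - c) / 2], and
   [1 + a ^ 2 = b ^ 2] for [b = (/ c + c) / 2]. *)
Lemma is_RInt_gen_pole x : 0 < x < PI / 2 ->
  is_RInt_gen (fun t => / (t ^ 2 - pole x) * (1 / sqrt (1 - t ^ 2)))
    (at_point 0) (at_left 1) (2 * PI * cos x ^ 2 / (1 - cos x ^ 4)).
Proof.
  intros Hx.
  assert (Hc : 0 < cos x) by (apply cos_gt_0; lra).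
  assert (Hs : 0 < sin x) by (apply sin_gt_0; lra).
  assert (Hsc := sin2_cos2 x); unfold Rsqr in Hsc.
  assert (Hc1 : cos x < 1) by nra.
  apply Rinv_0_lt_compat in Hc as Hi.
  assert (Hi1 : 1 < / cos x).
  { rewrite <- Rinv_1; apply Rinv_lt_contravar; lra. }
  assert (H4 : 0 < 1 - cos x ^ 4).
  { replace (1 - cos x ^ 4) with ((1 - cos x) * (1 + cos x) * (1 + cos x ^ 2)) by ring.
    repeat apply Rmult_lt_0_compat; nra. }
  replace (2 * PI * cos x ^ 2 / (1 - cos x ^ 4)) with
    (PI / (2 * ((/ cos x - cos x) / 2) * ((/ cos x + cos x) / 2))).
  2: { field; repeat split; nra. }
  apply is_RInt_gen_ext with
    (fun t => / (t ^ 2 + ((/ cos x - cos x) / 2) ^ 2) * (1 / sqrt (1 - t ^ 2))).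
  { apply filter_forall; intros _ t _; do 2 f_equal; unfold pole; field; lra. }
  apply is_RInt_gen_kernel; [lra|lra|field; lra].
Qed.

(* With [g] the derivative of [cheb_sum n] at [z], this is the residue
   [z ^ s / g] at [z = pole x], times the integral of
   [1 / ((t ^ 2 - z) sqrt (1 - t ^ 2))]. *)
Lemma pole_contribution s n i g :
  (i < Nat.div n 2)%nat ->
  g * (sin (node n (S i)) * (1 - cos (node n (S i)) ^ 4)) =
  4 * INR n * sin (INR n * node n (S i))
    * cosh (INR n * arcsinh (tan (node n (S i)))) * cos (node n (S i)) ^ 3 ->
  g <> 0 /\
  pole (node n (S i)) ^ s / g
    * (2 * PI * cos (node n (S i)) ^ 2 / (1 - cos (node n (S i)) ^ 4)) =
  PI * (-1) ^ s / (2 ^ (2 * s + 1) * INR n) * summand s n (S i).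
Proof.
  intros Hi.
  assert (Hn : (0 < n)%nat) by (destruct n; [simpl in Hi|]; lia).
  rewrite (proj1 (sin_cos_node n i Hn)).
  apply lt_0_INR in Hn.
  unfold summand, pole, tan; replace (S i - 1)%nat with i by lia.
  assert (Hx := node_bounds n i Hi).
  set (x := node n (S i)) in *.
  assert (Hc : 0 < cos x) by (apply cos_gt_0; lra).
  assert (Hs : 0 < sin x) by (apply sin_gt_0; lra).
  assert (Hsc := sin2_cos2 x); unfold Rsqr in Hsc.
  assert (H4 : 0 < 1 - cos x ^ 4).
  { replace (1 - cos x ^ 4) with (sin x * sin x * (1 + cos x ^ 2))
      by (replace (sin x * sin x) with (1 - cos x * cos x) by lra; ring).
    repeat apply Rmult_lt_0_compat; try lra; nra. }
  assert (Hch := cosh_pos (INR n * arcsinh (sin x / cos x))).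
  set (C := cosh _) in *.
  assert (He : (-1) ^ i * (-1) ^ i = 1).
  { rewrite <- Rpow_mult_distr; replace (-1 * -1) with 1 by ring; apply pow1. }
  assert (Hez : (-1) ^ i <> 0) by (apply pow_nonzero; lra).
  set (e := (-1) ^ i) in *.
  intros Hg.
  assert (Hgv : g = 4 * INR n * e * C * cos x ^ 3 / (sin x * (1 - cos x ^ 4))).
  { rewrite <- Hg; field; lra. }
  split.
  { intros Hg0; rewrite Hg0, Rmult_0_l in Hg; symmetry in Hg; revert Hg.
    assert (cos x ^ 3 <> 0) by (apply pow_nonzero; lra).
    clearbody C e.
    repeat apply Rmult_integral_contrapositive_currified; assumption || lra. }
  replace (- (/ cos x - cos x) ^ 2 / 4) with (-1 * / 2 ^ 2 * (sin x ^ 2 / cos x) ^ 2).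
  2: { replace (sin x ^ 2) with (1 - cos x ^ 2) by lra; field; lra. }
  rewrite !Rpow_mult_distr, pow_inv, <- !pow_mult, pow_add.
  set (X := (sin x ^ 2 / cos x) ^ (2 * s)).
  assert (H2 : 2 ^ (2 * s) <> 0) by (apply pow_nonzero; lra).
  rewrite Hgv.
  (* The sign [e] is in the denominator of the residue and in the numerator of the summand;
     [e * e = 1] reconciles the two. *)
  transitivity (PI * (-1) ^ s / (2 ^ (2 * s) * 2 ^ 1 * INR n)
    * ((e * e) / e * (sin x / cos x) / C * X)).
  - rewrite He; field; repeat split; lra.
  - field; repeat split; lra.
Qed.

(* The integral is improper at the endpoint 1, where 1 / sqrt (1 - t ^ 2) is
   unbounded: [is_RInt_gen] states both its convergence and its value. *)
Theorem theorem3 (s n : nat) (hs : (s < Nat.div n 2)%nat) :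
  is_RInt_gen (integrand s n) (at_point 0) (at_left 1)
    (PI * (-1) ^ s / (2 ^ (2 * s + 1) * INR n)
     * sum_n_m (summand s n) 1 (Nat.div n 2)).
Proof.
  assert (Hn : (0 < n)%nat) by (destruct n; [simpl in hs|]; lia).
  assert (HE := cheb_sum_poly_lt n).
  assert (Hnode := node_bounds n).
  assert (Hres := pole_contribution s n).
  (* The poles are indexed from 0 to [m], the nodes from 1 to [m + 1]; [hs] becomes [s <= m], the
     range in which interpolation is exact. *)
  destruct (Nat.div n 2) as [|m]; [lia|].
  set (z := fun j => pole (node n (S j))).
  assert (Hcos : forall j, (j <= m)%nat -> 0 < cos (node n (S j))).
  { intros j Hj; destruct (Hnode j); [lia|]; apply cos_gt_0; lra. }
  destruct (partial_fractions m (cheb_sum n) z HE) as [g [Hg Hpf]].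
  { intros i j Hi Hj H; apply pole_inj in H; [|apply Hnode; lia..].
    exact (node_inj n i j Hn H). }
  { intros j Hj; unfold z; rewrite cheb_sum_pole by now apply Hcos.
    rewrite (proj2 (sin_cos_node n j Hn)); ring. }
  assert (Hr : forall j, (j <= m)%nat -> _) by
    (intros j Hj; destruct (Hg j Hj) as [Hd Hf];
     exact (Hres j (g j (z j)) ltac:(lia)
       (quotient_at_pole n (g j) _ (Hcos j Hj) (proj2 (sin_cos_node n j Hn)) Hd Hf))).
  specialize (Hpf (fun j Hj => proj1 (Hr j Hj))).
  rewrite <- sum_n_m_S.
  change (sum_n_m (fun j => summand s n (S j)) 0 m) with (sum_n (fun j => summand s n (S j)) m).
  change Rmult with (@mult R_Ring) at 1.
  rewrite <- (sum_n_mult_l (K := R_Ring)).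
  (* The partial fraction expansion of the integrand, to be integrated term by term. *)
  apply is_RInt_gen_ext with (fun t => sum_n (fun j =>
    scal (z j ^ s / g j (z j)) (/ (t ^ 2 - z j) * (1 / sqrt (1 - t ^ 2)))) m).
  - apply filter_prod_0_left_1_strict; intros t Ht.
    unfold integrand; rewrite denominator_cheb_sum by exact Ht.
    assert (HEt := denominator_pos n t Hn Ht).
    rewrite pow_mult, (Hpf s (t ^ 2)) by lia.
    set (w := / cheb_sum n (t ^ 2) * (1 / sqrt (1 - t ^ 2))).
    set (u := fun j => z j ^ s / g j (z j) * g j (t ^ 2)).
    match goal with |- ?x = ?y => change (x = y :> R) end.
    transitivity (sum_n u m * w); [|unfold w, Rdiv; ring].
    rewrite <- (sum_n_mult_r (K := R_Ring) w u m : _ = sum_n u m * w).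
    apply sum_n_ext_loc; intros j Hj; unfold u, w.
    destruct (Hg j Hj) as [_ Hf].
    change (z j ^ s / g j (z j) * (/ (t ^ 2 - z j) * (1 / sqrt (1 - t ^ 2))) =
      z j ^ s / g j (z j) * g j (t ^ 2)
        * (/ cheb_sum n (t ^ 2) * (1 / sqrt (1 - t ^ 2)))).
    (* The denominator is positive, so neither of its two factors vanishes. *)
    rewrite (Hf (t ^ 2)) in HEt |- *.
    assert (0 < sqrt (1 - t ^ 2)) by (apply sqrt_lt_R0; nra).
    assert (t ^ 2 - z j <> 0) by (intros e; rewrite e in HEt; lra).
    assert (g j (t ^ 2) <> 0) by (intros e; rewrite e in HEt; lra).
    field; repeat split; try assumption; [lra|exact (proj1 (Hr j Hj))].
  - rewrite (sum_n_ext_loc _ (fun j => scal (z j ^ s / g j (z j))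
      (2 * PI * cos (node n (S j)) ^ 2 / (1 - cos (node n (S j)) ^ 4)))).
    + refine (is_RInt_gen_sum_n _ _ (fun j t => scal (z j ^ s / g j (z j))
        (/ (t ^ 2 - z j) * (1 / sqrt (1 - t ^ 2)))) _ m _); intros j Hj.
      apply (is_RInt_gen_scal (V := R_NormedModule)).
      apply is_RInt_gen_pole, Hnode; lia.
    + intros j Hj; symmetry; exact (proj2 (Hr j Hj)).
Qed.
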